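(* Let $\Gamma=F(A_1,\dots,A_k)$, $k\ge2$, let $l_1,\dots,l_k$ be positive integers and $a_1,\dots,a_k$ integers, and set $$N_{\Gamma,a_1,\dots,a_k}(m)=\#\{\gamma\in\Gamma_c:\mathrm{wl}(\gamma)\le m,\ \log_i(\gamma)\equiv a_i\ (\mathrm{mod}\ l_i),\ i=1,\dots,k\}.$$ (a) If $2\nmid\gcd(l_1,\dots,l_k)$ (i.e. not all $l_j$ are even), then $$\frac{N_{\Gamma,a_1,\dots,a_k}(m)}{\#\{\gamma\in\Gamma_c:\mathrm{wl}(\gamma)\le m\}}\to\frac{1}{l_1l_2\cdots l_k}\quad\text{as }m\to\infty.$$ (b) If $l_1,\dots,l_k$ are all even, then $$\frac12\left(\frac{N_{\Gamma,a_1,\dots,a_k}(m)}{\#\{\gamma\in\Gamma_c:\mathrm{wl}(\gamma)\le m\}}+\frac{N_{\Gamma,a_1,\dots,a_k}(m+1)}{\#\{\gamma\in\Gamma_c:\mathrm{wl}(\gamma)\le m+1\}}\right)\to\frac{1}{l_1l_2\cdots l_k}\quad\text{as }m\to\infty.$$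
   Context: $\Gamma_c$ is the set of cyclically reduced words in $\Gamma$ (reduced words whose first letter times last letter is not the identity), $\mathrm{wl}$ is word length with respect to $A_1^{\pm1},\dots,A_k^{\pm1}$, and $\log_i:\Gamma\to\mathbb{Z}$ is the homomorphism with $\log_i(A_j)=\delta_{ij}$ (exponent sum of $A_i$). *)

(* Defs.v *)
From HB Require Import structures.
From mathcomp Require Import all_boot all_order all_fingroup all_algebra finmap.
From mathcomp Require Import all_classical all_reals all_analysis.

Set Implicit Arguments.
Unset Strict Implicit.
Unset Printing Implicit Defensive.

Import Order.TTheory GRing.Theory Num.Theory.
Import numFieldNormedType.Exports.

Local Open Scope classical_set_scope.
Local Open Scope ring_scope.

(* (i, false) stands for A_i and (i, true) for A_i^-1. *)
Definition letter (k : nat) : Type := ('I_k * bool)%type.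
HB.instance Definition _ k := Finite.copy (letter k) ('I_k * bool)%type.

Definition linv k (s : letter k) : letter k := (s.1, ~~ s.2).

Definition reduced k (w : seq (letter k)) : bool :=
  sorted (fun s t => t != linv s) w.

Definition push k (s : letter k) (w : seq (letter k)) : seq (letter k) :=
  if w is t :: w' then if t == linv s then w' else s :: w else [:: s].

Lemma linvK k : involutive (@linv k).
Proof. by case=> i b; rewrite /linv /= negbK. Qed.

Lemma reduced_cons k (s : letter k) w : reduced (s :: w) -> reduced w.
Proof. exact: path_sorted. Qed.

Lemma reduced_push k (s : letter k) w : reduced w -> reduced (push s w).
Proof.
case: w => [|t w] //= rw; case: eqP => [_|/eqP nts]; first exact: path_sorted rw.
by rewrite /reduced /= nts.
Qed.

Lemma pushK k (s : letter k) w : reduced w -> push s (push (linv s) w) = w.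
Proof.
case: w => [_|t w] /=; first by rewrite eqxx.
rewrite linvK; case: eqP => [->|_ _ /=]; last by rewrite eqxx.
by case: w => [|u w] //= /andP[/negbTE -> _].
Qed.

Lemma push_reduced k (s : letter k) w : reduced (s :: w) -> push s w = s :: w.
Proof. by case: w => [|t w] //= /andP[/negbTE -> _]. Qed.

(* The free group F(A_1, ..., A_k), realized as the reduced words under
   concatenation followed by free reduction. *)
Record freegroup (k : nat) :=
  FreeWord { fword :> seq (letter k); fwordP : reduced fword }.
HB.instance Definition _ k := [isSub for @fword k].
HB.instance Definition _ k := [Choice of freegroup k by <:].

Section FreeGroup.
Variable k : nat.
Implicit Types (s : letter k) (w : seq (letter k)) (x y z : freegroup k).

Definition wmul w w' : seq (letter k) := foldr (@push k) w' w.

Definition winv w : seq (letter k) := rev (map (@linv k) w).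

Lemma reduced_wmul w w' : reduced w' -> reduced (wmul w w').
Proof. by move=> rw'; elim: w => //= s w; apply: reduced_push. Qed.

Lemma reduced_winv w : reduced w -> reduced (winv w).
Proof.
rewrite /reduced /winv rev_sorted sorted_map.
apply: sub_sorted => s t /=; apply: contra => /eqP.
by rewrite linvK => ->.
Qed.

Lemma wmulw0 w : reduced w -> wmul w [::] = w.
Proof.
elim: w => //= s w IH rsw.
by rewrite IH ?push_reduced ?(reduced_cons rsw).
Qed.

Lemma wmul_push s w w' : reduced w' ->
  wmul (push s w) w' = push s (wmul w w').
Proof.
case: w => [|t w] //= rw'; case: eqP => [->|//].
by rewrite pushK ?reduced_wmul.
Qed.

Lemma wmulA w w' w'' : reduced w'' ->
  wmul w (wmul w' w'') = wmul (wmul w w') w''.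
Proof. by move=> rw''; elim: w => //= s w ->; rewrite wmul_push. Qed.

Lemma wmul_cat w1 w2 w' : wmul (w1 ++ w2) w' = wmul w1 (wmul w2 w').
Proof. exact: foldr_cat. Qed.

Lemma wmul_winvK w w' : reduced w' -> wmul w (wmul (winv w) w') = w'.
Proof.
move=> rw'; elim: w w' rw' => // s w IH w' rw'.
rewrite /winv /= rev_cons -cats1 wmul_cat IH ?pushK //=.
exact: reduced_push.
Qed.

Lemma winvK : involutive winv.
Proof. by move=> w; rewrite /winv map_rev revK (mapK (@linvK k)). Qed.

Definition fgmul x y : freegroup k :=
  FreeWord (reduced_wmul x (fwordP y)).
Definition fg1 : freegroup k := @FreeWord k [::] isT.
Definition fginv x : freegroup k := FreeWord (reduced_winv (fwordP x)).

Lemma fgmulA : associative fgmul.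
Proof. by move=> x y z; apply: val_inj => /=; apply/wmulA/fwordP. Qed.
Lemma fgmul1g : left_id fg1 fgmul.
Proof. by move=> x; apply: val_inj. Qed.
Lemma fgmulg1 : right_id fg1 fgmul.
Proof. by move=> x; apply: val_inj; apply/wmulw0/fwordP. Qed.
Lemma fgmulgV : right_inverse fg1 fginv fgmul.
Proof.
move=> x; apply: val_inj => /=.
by rewrite -[winv x]wmulw0 ?wmul_winvK // reduced_winv ?fwordP.
Qed.
Lemma fgmulVg : left_inverse fg1 fginv fgmul.
Proof.
move=> x; rewrite -[x in fgmul _ x](_ : fginv (fginv x) = x) ?fgmulgV //.
by apply: val_inj; rewrite /= winvK.
Qed.

End FreeGroup.

HB.instance Definition _ k := isGroup.Build (freegroup k)
  (@fgmulA k) (@fgmul1g k) (@fgmulg1 k) (@fgmulVg k) (@fgmulgV k).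

Definition fgen k (i : 'I_k) : freegroup k :=
  @FreeWord k [:: (i, false)] isT.

(* The element A_i or A_i^-1 denoted by a letter. *)
Definition fletter k (s : letter k) : freegroup k :=
  if s.2 then (fgen s.1)^-1%g else fgen s.1.

Definition fprod k (w : seq (letter k)) : freegroup k :=
  (\prod_(s <- w) fletter s)%g.

Lemma fword_fletter k (s : letter k) : fword (fletter s) = [:: s].
Proof. by case: s => i []. Qed.

Lemma fprod_cons k (s : letter k) w :
  fword (fprod (s :: w)) = push s (fword (fprod w)).
Proof.
rewrite /fprod big_cons.
by rewrite /= fword_fletter.
Qed.

Lemma fprodK k (x : freegroup k) : fprod (fword x) = x.
Proof.
apply: val_inj; case: x => w /=; elim: w => [|s w IH] rw.
  by rewrite /fprod big_nil.
by rewrite fprod_cons (IH (reduced_cons rw)) push_reduced.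
Qed.

Lemma size_fprod k (w : seq (letter k)) : (size (fword (fprod w)) <= size w)%N.
Proof.
elim: w => [|s w IH]; first by rewrite /fprod big_nil.
rewrite fprod_cons /=; case: (fword _) IH => //= t w' IH.
by case: ifP => //= _; apply: leq_trans (leqnSn _); apply: ltnW.
Qed.

Lemma wl_subproof k (x : freegroup k) :
  exists n, [exists w : n.-tuple (letter k), fprod w == x].
Proof.
exists (size (fword x)); apply/existsP; exists (in_tuple (fword x)).
by rewrite fprodK.
Qed.

(* Word length: the least number of factors A_i^{+1}, A_i^{-1} in an
   expression of x. *)
Definition wl k (x : freegroup k) : nat := ex_minn (wl_subproof x).

Lemma wlE k (x : freegroup k) : wl x = size (fword x).
Proof.
rewrite /wl; case: ex_minnP => n /existsP[w /eqP wx] nmin.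
apply/eqP; rewrite eqn_leq nmin /=.
  by rewrite -wx (leq_trans (size_fprod _)) ?size_tuple.
by apply/existsP; exists (in_tuple (fword x)); rewrite fprodK.
Qed.

(* Exponent sum of A_i. *)
Definition log k (i : 'I_k) (x : freegroup k) : int :=
  \sum_(s <- fword x | s.1 == i) (-1) ^+ s.2.

Lemma log_fgen k (i j : 'I_k) : log i (fgen j) = (i == j)%:R.
Proof. by rewrite /log /= big_cons big_nil /= eq_sym; case: eqP. Qed.

Lemma logM k (i : 'I_k) (x y : freegroup k) :
  log i (x * y)%g = log i x + log i y.
Proof.
have push_log s (w : seq (letter k)) :
    \sum_(t <- push s w | t.1 == i) (-1) ^+ t.2 =
    \sum_(t <- s :: w | t.1 == i) (-1) ^+ t.2 :> int.
  case: w => [|t w] //=; case: eqP => // ->; rewrite !big_cons /linv /=.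
  case: (s.1 == i) => //; case: s.2 => /=.
    by rewrite addrA addNr add0r.
  by rewrite addrA subrr add0r.
rewrite /log /=; elim: (fword x) => [|s w IH] /=; first by rewrite big_nil add0r.
by rewrite push_log !big_cons IH; case: ifP; rewrite ?addrA.
Qed.

(* The condition is vacuous for the identity, i.e. the empty word. *)
Definition cyclically_reduced k (x : freegroup k) : Prop :=
  if fword x is s :: w then (fletter s * fletter (last s w) <> 1)%g else True.

Definition Gamma_c (k : nat) : set (freegroup k) :=
  [set x | cyclically_reduced x].

Lemma finite_ball k (m : nat) : finite_set [set x : freegroup k | (wl x <= m)%N].
Proof.
apply: (@sub_finite_set _ _
  (\bigcup_(n in `I_m.+1) ((fun w : n.-tuple (letter k) => fprod w) @` setT))).
  move=> x /= xm; exists (wl x); first by rewrite /= ltnS.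
  by rewrite wlE; exists (in_tuple (fword x)); rewrite //= fprodK.
apply: bigcup_finite => // n _; apply: finite_image; exact: finite_finset.
Qed.

Definition ball_c (k m : nat) : set (freegroup k) :=
  [set x | Gamma_c x /\ (wl x <= m)%N].

Definition congr_ball_c (k : nat) (l : 'I_k -> nat) (a : 'I_k -> int) (m : nat) :
    set (freegroup k) :=
  [set x | [/\ Gamma_c x, (wl x <= m)%N &
             forall i, (log i x = a i %[mod (l i)%:Z])%Z]].

Lemma finite_ball_c k m : finite_set (@ball_c k m).
Proof. by apply: sub_finite_set (finite_ball k m) => x []. Qed.

Lemma finite_congr_ball_c k (l : 'I_k -> nat) a m :
  finite_set (congr_ball_c l a m).
Proof. by apply: sub_finite_set (finite_ball k m) => x []. Qed.

(* [fset_set] is the empty set on infinite sets; [finite_ball_c] and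
   [finite_congr_ball_c] rule that case out. *)
Definition total_Gamma (k m : nat) : nat := #|` fset_set (@ball_c k m)|%fset.

Definition N_Gamma (k : nat) (l : 'I_k -> nat) (a : 'I_k -> int) (m : nat) : nat :=
  #|` fset_set (congr_ball_c l a m)|%fset.

(* Main.v *)
Require Import Defs.
From HB Require Import structures.
From mathcomp Require Import all_boot all_order all_fingroup all_algebra finmap.
From mathcomp Require Import all_classical all_reals all_analysis.
From mathcomp Require Import zify ring lra.

Import Order.TTheory GRing.Theory Num.Theory.
Import numFieldNormedType.Exports.

Local Open Scope classical_set_scope.
Local Open Scope ring_scope.

Set Implicit Arguments.
Unset Strict Implicit.
Unset Printing Implicit Defensive.

(* Put q = 2k - 1.  A cyclically reduced word of length n > 0 is a closed
   non-backtracking path of length n in the graph of letters, so the number of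
   those in a given congruence class is q^n times a sum over letters s of
   transition probabilities P^n((s, 0), (s, a)), where P is the non-backtracking
   walk on the finite state space (letters) x prod_i Z/l_i.  This chain is doubly
   stochastic, and explicit loops with trivial or one-letter displacement show
   that it is irreducible.  If some l_i is odd it is aperiodic, and P^n tends to
   the uniform law; if all l_i are even the parity of the displacement splits the
   states into two classes of equal size exchanged by P, and P^n + P^(n+1) tends
   to twice the uniform law.  Balls are geometrically weighted averages of the
   sphere densities, and the total count is the case where all l_i are 1. *)

(** * Powers of a doubly stochastic kernel on a finite set and their limits *)

Section Kernel.
Variables (R : realType) (X : finType) (K : X -> X -> R).

Fixpoint kpow n x y : R :=
  if n is n'.+1 then \sum_z K x z * kpow n' z y else (x == y)%:R.

Lemma sum_delta x (f : X -> R) : \sum_z (x == z)%:R * f z = f x.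
Proof.
rewrite (bigD1 x) //= eqxx mul1r big1 ?addr0 // => z /negbTE.
by rewrite eq_sym => ->; rewrite mul0r.
Qed.

Lemma kpow1 x y : kpow 1 x y = K x y.
Proof.
rewrite /= (bigD1 y) //= eqxx mulr1 big1 ?addr0 // => z /negbTE ->.
by rewrite mulr0.
Qed.

Lemma kpowD m n x y : kpow (m + n) x y = \sum_z kpow m x z * kpow n z y.
Proof.
elim: m x => [|m IH] x /=; first by rewrite sum_delta.
under eq_bigr do rewrite IH mulr_sumr.
rewrite exchange_big; apply: eq_bigr => z _ /=.
by rewrite mulr_suml; apply: eq_bigr => t _; rewrite mulrA.
Qed.

(** Every step of nonzero weight flips [c], so [n] steps change it by the parity of [n]. *)
Lemma kpow_bipartite0 (c : X -> bool) n x y :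
    (forall x y, c x = c y -> K x y = 0) ->
  (c x (+) odd n) != c y -> kpow n x y = 0.
Proof.
move=> Kc; elim: n x => [|n IH] x /=.
  by rewrite addbF; have [->|//] := eqVneq x y; rewrite eqxx.
move=> xy; rewrite big1 // => z _.
have [/Kc ->|xz] := eqVneq (c x) (c z); first by rewrite mul0r.
rewrite IH ?mulr0 //; move: xz xy.
by case: (c x); case: (c y); case: (c z); case: (odd n).
Qed.

Hypothesis K_ge0 : forall x y, 0 <= K x y.

Lemma kpow_ge0 n x y : 0 <= kpow n x y.
Proof.
by elim: n x => [|n IH] x //=; apply: sumr_ge0 => z _; rewrite mulr_ge0.
Qed.

Lemma kpow_comp_gt0 m n x y z :
  0 < kpow m x y -> 0 < kpow n y z -> 0 < kpow (m + n) x z.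
Proof.
move=> xy yz; rewrite kpowD (bigD1 y) //= ltr_pwDl ?mulr_gt0 //.
by apply: sumr_ge0 => t _; rewrite mulr_ge0 ?kpow_ge0.
Qed.

Lemma kpow_lower_bound n :
  exists2 d, 0 < d & forall x y, 0 < kpow n x y -> d <= kpow n x y.
Proof.
pose f (p : X * X) := kpow n p.1 p.2.
exists (\big[Num.min/1]_(p | 0 < f p) f p); first exact: lt_bigmin.
by move=> x y xy; apply: (bigmin_le_cond _ (j := (x, y))).
Qed.

Hypothesis K_row : forall x, \sum_y K x y = 1.

Lemma kpow_row n x : \sum_y kpow n x y = 1.
Proof.
elim: n x => [|n IH] x /=.
  by rewrite -[RHS](sum_delta x (fun=> 1)); apply: eq_bigr => y _; rewrite mulr1.
rewrite exchange_big /= -[RHS](K_row x); apply: eq_bigr => y _.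
by rewrite -mulr_sumr IH mulr1.
Qed.

Lemma evolve_kpow (h : nat -> X -> R) :
  (forall n x, h n.+1 x = \sum_z K x z * h n z) ->
  forall r n x, h (n + r)%N x = \sum_z kpow r x z * h n z.
Proof.
move=> hS; elim=> [|r IH] n x; first by rewrite addn0 /= sum_delta.
rewrite addnS hS /=; under eq_bigr do rewrite IH mulr_sumr.
rewrite exchange_big; apply: eq_bigr => z _ /=.
by rewrite mulr_suml; apply: eq_bigr => t _; rewrite mulrA.
Qed.

(* Since [h n] sums to zero over [C x], [kpow r x] may be replaced there by
   [kpow r x - d], whose total mass is at most [1 - d]. *)
Lemma evolve_cvg0 (h : nat -> X -> R) (C : X -> {set X}) r d :
    (0 < r)%N -> 0 < d ->
    (forall n x, h n.+1 x = \sum_z K x z * h n z) ->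
    (forall n x, \sum_(z in C x) h n z = 0) ->
    (forall x z, z \in C x -> d <= kpow r x z) ->
    (forall x z, z \notin C x -> kpow r x z = 0) ->
  forall x, h n x @[n --> \oo] --> (0 : R).
Proof.
move=> r0 d0 hS hC dK K0 x.
have sumC y : \sum_(z in C y) kpow r y z = 1.
  rewrite -(kpow_row r y) [RHS](bigID [in C y]) /= [X in _ + X]big1 ?addr0 //.
  exact: K0.
have C0 y : (0 < #|C y|)%N.
  rewrite lt0n; apply: contra_eq_neq (sumC y) => /eqP.
  by rewrite cards_eq0 => /eqP ->; rewrite big_set0 eq_sym oner_neq0.
have d1 : d <= 1.
  have /card_gt0P[z zC] := C0 x.
  rewrite -(sumC x) (bigD1 z) //= ler_wpDr ?dK //.
  by apply: sumr_ge0 => t _; apply: kpow_ge0.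
pose B := \sum_y `|h 0%N y|.
(* Averaging against a probability row never increases the sup norm; this covers the times between
   multiples of [r]. *)
have contr t n (b : R) : 0 <= b -> (forall y, `|h n y| <= b) ->
    forall y, `|h (n + t)%N y| <= b.
  move=> b0 hb y; rewrite (evolve_kpow hS) (le_trans (ler_norm_sum _ _ _)) //.
  rewrite -[b]mul1r -(kpow_row t y) mulr_suml; apply: ler_sum => z _.
  by rewrite normrM (ger0_norm (kpow_ge0 _ _ _)) ler_wpM2l ?kpow_ge0.
have bound j : forall y, `|h (r * j)%N y| <= B * (1 - d) ^+ j.
  elim: j => [|j IH] y.
    rewrite muln0 expr0 mulr1 /B (bigD1 y) //= lerDl.
    by apply: sumr_ge0.
  rewrite mulnS addnC (evolve_kpow hS).
  rewrite (bigID [in C y]) /= [X in _ + X]big1 ?addr0 => [|z /K0 ->]; last first.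
    by rewrite mul0r.
  have -> : \sum_(z in C y) kpow r y z * h (r * j)%N z =
            \sum_(z in C y) (kpow r y z - d) * h (r * j)%N z.
    under [RHS]eq_bigr do rewrite mulrBl.
    by rewrite sumrB -mulr_sumr hC mulr0 subr0.
  rewrite (le_trans (ler_norm_sum _ _ _)) //.
  apply: (@le_trans _ _ (\sum_(z in C y) (kpow r y z - d) * (B * (1 - d) ^+ j))).
    apply: ler_sum => z zC; rewrite normrM ger0_norm ?subr_ge0 ?dK //.
    by rewrite ler_wpM2l ?subr_ge0 ?dK.
  rewrite -mulr_suml mulrC exprSr mulrA; apply: ler_wpM2l.
    by rewrite mulr_ge0 ?sumr_ge0 // exprn_ge0 // subr_ge0.
  (* The reduced row has mass [1 - d * #|C y|], which is at most [1 - d] because [C y] is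
     nonempty. *)
  rewrite sumrB sumC lerB // sumr_const -[X in X <= _]mulr1n.
  by rewrite ler_wpMn2l // ltW.
have geo : B * (1 - d) ^+ j @[j --> \oo] --> (0 : R).
  rewrite -(mulr0 B); apply: cvgMr; apply: cvg_expr.
  by rewrite ger0_norm ?subr_ge0 // gtrBl.
apply/cvgr0Pnorm_le => e e0.
have [j _ /(_ j (leqnn _)) /= jP] := (cvgr0_norm_le _ geo) e e0.
exists (r * j)%N => // n /= rn; rewrite -(subnKC rn).
apply: contr => [|y]; first exact: ltW.
by rewrite (le_trans (bound _ _)) // (le_trans (ler_norm _)).
Qed.

Hypothesis K_col : forall y, \sum_x K x y = 1.

Lemma kpow_col n y : \sum_x kpow n x y = 1.
Proof.
elim: n y => [|n IH] y /=.
  by rewrite -[RHS](sum_delta y (fun=> 1)); apply: eq_bigr => x _; rewrite eq_sym mulr1.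
rewrite exchange_big /= -[RHS](IH y); apply: eq_bigr => x _.
by rewrite -mulr_suml K_col mul1r.
Qed.

(** The deviations from [#|X|^-1] in a fixed column evolve by [K] and, by the column sums, add up to
    zero; [evolve_cvg0] applies with the whole space as [C x]. *)
Lemma kpow_cvg_uniform r : (0 < r)%N -> (forall x y, 0 < kpow r x y) ->
  forall x y, kpow n x y @[n --> \oo] --> (#|X|%:R^-1 : R).
Proof.
move=> r0 rpos x y; have [d d0 dP] := kpow_lower_bound r.
have X0 : #|X|%:R != 0 :> R by rewrite pnatr_eq0 -lt0n; apply/card_gt0P; exists x.
suff : kpow n x y - #|X|%:R^-1 @[n --> \oo] --> (0 : R).
  by move/cvg_sub0; apply; apply: cvg_cst.
apply: (@evolve_cvg0 (fun n x => kpow n x y - #|X|%:R^-1) 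
  (fun=> finset.setTfor X) r d _ _ _ _ _ _ x)
  => // [n z|n z|z t _|z t].
- rewrite /=; under [RHS]eq_bigr do rewrite mulrBr.
  by rewrite sumrB -mulr_suml K_row mul1r.
- under eq_bigl do rewrite inE.
  by rewrite sumrB kpow_col sumr_const cardT -cardE -[_ *+ _]mulr_natr mulVf ?subrr.
- exact: dP.
- by rewrite inE.
Qed.

(** The subtracted term is the uniform law on the class that can be occupied at time [n]. As [r] is
    even, [r] steps stay in the class of the start, which serves as [C x] in [evolve_cvg0]. *)
Lemma kpow_cvg_bipartite (c : X -> bool) r :
    (forall x y, c x = c y -> K x y = 0) ->
    (0 < r)%N -> ~~ odd r -> (forall x y, c x = c y -> 0 < kpow r x y) ->
  forall x y, kpow n x y - ((c x (+) odd n) == c y)%:R * (2 / #|X|%:R)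
                @[n --> \oo] --> (0 : R).
Proof.
move=> Kc r0 er rpos x y; have [d d0 dP] := kpow_lower_bound r.
have X0 : #|X|%:R != 0 :> R by rewrite pnatr_eq0 -lt0n; apply/card_gt0P; exists x.
pose S b : R := \sum_x (c x == b)%:R.
(* All mass leaving one class lands in the other; unit row and column sums then force the classes to
   have equal size. *)
have SN b : S b = S (~~ b).
  rewrite /S; transitivity (\sum_x \sum_z K x z * (c z == ~~ b)%:R).
    apply: eq_bigr => u _; rewrite -[LHS]mulr1 -(K_row u) mulr_sumr.
    apply: eq_bigr => z _; rewrite mulrC.
    have [/Kc ->|] := eqVneq (c u) (c z); first by rewrite !mul0r.
    by case: (c u); case: (c z); case: b.
  rewrite exchange_big; apply: eq_bigr => z _ /=.
  by rewrite -mulr_suml K_col mul1r.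
have Sb b : S b = #|X|%:R / 2.
  have : S b + S (~~ b) = #|X|%:R.
    rewrite /S -big_split /= -sumr_const; apply: eq_bigr => z _.
    by case: (c z); case: b; rewrite /= ?addr0 ?add0r.
  by rewrite -SN; lra.
apply: (@evolve_cvg0
  (fun n x => kpow n x y - ((c x (+) odd n) == c y)%:R * (2 / #|X|%:R))
  (fun x => [set z | c z == c x]%SET) r d _ _ _ _ _ _ x) => // [n z|n z|z t|z t].
- rewrite /=; under [RHS]eq_bigr do rewrite mulrBr.
  rewrite sumrB; congr (_ - _); rewrite -[LHS]mul1r -(K_row z) mulr_suml.
  apply: eq_bigr => t _.
  have [/Kc ->|] := eqVneq (c z) (c t); first by rewrite !mul0r.
  by case: (c z); case: (c t); case: (odd n).
- under eq_bigl do rewrite inE.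
  rewrite big_mkcond /=.
  (* If the class of [z] cannot reach [y] in [n] steps, all terms vanish. Otherwise the other class
     cannot, so the sum over the class of [z] extends to the whole column, of sum 1. *)
  transitivity (\sum_t ((c z (+) odd n) == c y)%:R *
    (kpow n t y - (c t == c z)%:R * (2 / #|X|%:R))).
    apply: eq_bigr => t _; have [tz|tz] := eqVneq (c t) (c z).
      rewrite tz mul1r; have [_|nz] := eqVneq; first by rewrite !mul1r.
      by rewrite (kpow_bipartite0 Kc) ?tz // !mul0r subrr.
    rewrite mul0r subr0; have [zy|] := eqVneq; rewrite ?mul0r //.
    rewrite mul1r (kpow_bipartite0 Kc) //.
    by move: tz zy; case: (c t); case: (c z); case: (odd n); case: (c y).
  rewrite -mulr_sumr sumrB kpow_col -mulr_suml -/(S (c z)) Sb.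
  by rewrite mulrA divfK ?pnatr_eq0 // divff // subrr mulr0.
- by rewrite inE => /eqP tz; apply/dP/rpos.
- by rewrite inE => tz; apply: (kpow_bipartite0 Kc); rewrite (negbTE er) addbF eq_sym.
Qed.
End Kernel.

Arguments kpow : simpl never.

Lemma sum_indicator (R : pzSemiRingType) (X : finType) (p : pred X) :
  \sum_x (p x)%:R = #|[pred x | p x]|%:R :> R.
Proof.
rewrite -sum1_card natr_sum [RHS]big_mkcond; apply: eq_bigr => x _.
by rewrite inE; case: (p x).
Qed.

Lemma cvg_sumr (R : realType) (I : Type) (r : seq I) (u : I -> nat -> R) (v : I -> R) :
  (forall i, u i n @[n --> \oo] --> v i) ->
  \sum_(i <- r) u i n @[n --> \oo] --> \sum_(i <- r) v i.
Proof. by move=> uv; apply: cvg_big => [|i _]; [exact: add_continuous | exact: uv]. Qed.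

(** * The non-backtracking walk on letters times a finite set *)

Lemma card_letter k : #|{: letter k}| = (k * 2)%N.
Proof. by rewrite [LHS](card_prod 'I_k bool) card_ord card_bool. Qed.

Lemma card_letter_neq k (s : letter k) : #|[pred t | t != s]| = (k * 2).-1.
Proof.
rewrite -card_letter [in RHS](cardD1 s) inE add1n /=.
by apply: eq_card => t; rewrite !inE andbT.
Qed.

Lemma linv_neq k (s : letter k) : s != linv s.
Proof. by case: s => i []; apply/eqP => -[]. Qed.

Definition run k (G : Type) (T : letter k -> G -> G) (w : seq (letter k)) g :=
  foldl (fun g s => T s g) g w.

Section Walk.
Variables (R : realType) (k : nat) (G : finType) (T : letter k -> G -> G).
Implicit Types (s t u : letter k) (g : G) (w : seq (letter k)).
Implicit Types (x y z : letter k * G).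

Notation q := (k * 2).-1.
Hypothesis k_gt1 : (1 < k)%N.
Hypothesis TK : forall s, cancel (T s) (T (linv s)).
Hypothesis TC : forall s t g, T s (T t g) = T t (T s g).
Hypothesis T_trans : forall g g', exists w, run T w g = g'.

Lemma TVK s : cancel (T (linv s)) (T s).
Proof. by move=> g; rewrite -{1}(linvK s) TK. Qed.

(** A step applies the letter being left. Hence [n] steps from letter [s] back to [s] read off a
    word of length [n] starting with [s], and the last step imposes the cyclic condition. *)
Definition nb_step x y : bool := (y.1 != linv x.1) && (y.2 == T x.1 x.2).
Definition nb_ker x y : R := (nb_step x y)%:R / q%:R.

Lemma q_gt0 : 0 < q%:R :> R.
Proof. by rewrite ltr0n; lia. Qed.

Lemma nb_ker_ge0 x y : 0 <= nb_ker x y.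
Proof. by rewrite divr_ge0 ?ler0n. Qed.

Lemma nb_ker_row x : \sum_y nb_ker x y = 1.
Proof.
rewrite -mulr_suml -(pair_big xpredT xpredT (fun t g => (nb_step x (t, g))%:R)) /=.
rewrite (eq_bigr (fun t => (t != linv x.1)%:R)) => [|t _]; last first.
  rewrite (bigD1 (T x.1 x.2)) //= big1 ?addr0 => [|g /negbTE ng].
    by rewrite /nb_step /= eqxx andbT.
  by rewrite /nb_step /= ng andbF.
by rewrite sum_indicator card_letter_neq divff // gt_eqF ?q_gt0.
Qed.

(** Each [T t] is a bijection, so a state has exactly one predecessor for each of the [q] letters
    [t] other than [linv y.1]. *)
Lemma nb_ker_col y : \sum_x nb_ker x y = 1.
Proof.
rewrite -mulr_suml -(pair_big xpredT xpredT (fun t g => (nb_step (t, g) y)%:R)) /=.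
rewrite (eq_bigr (fun t => (t != linv y.1)%:R)) => [|t _]; last first.
  have tE : (y.1 != linv t) = (t != linv y.1).
    by rewrite eq_sym (inv_eq (@linvK k)).
  rewrite (bigD1 (T (linv t) y.2)) //= big1 ?addr0 => [|g ng].
    by rewrite /nb_step /= TVK eqxx andbT tE.
  rewrite /nb_step /=; have [yg|_] := eqVneq y.2 (T t g); last by rewrite andbF.
  by rewrite yg TK eqxx in ng.
by rewrite sum_indicator card_letter_neq divff // gt_eqF ?q_gt0.
Qed.

Notation P n s g t g' := (kpow nb_ker n (s, g) (t, g')).

Lemma nb_comp m n s t u g g' g'' :
  0 < P m s g t g' -> 0 < P n t g' u g'' -> 0 < P (m + n) s g u g''.
Proof. exact: (kpow_comp_gt0 nb_ker_ge0). Qed.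

Lemma nb_walk w s t g : path (fun s t => t != linv s) s (rcons w t) ->
  0 < P (size w).+1 s g t (run T (s :: w) g).
Proof.
have step1 s' t' g' : t' != linv s' -> 0 < P 1 s' g' t' (T s' g').
  by move=> st; rewrite kpow1 /nb_ker /nb_step /= st eqxx /= divr_gt0 ?q_gt0.
elim: w s g => [|u w IH] s g /= => [/andP[st _]|/andP[us uw]].
  exact: step1.
by rewrite -add1n; apply: nb_comp (IH _ _ uw); apply: step1.
Qed.

Lemma other_letter s : exists v : letter k, v.1 != s.1.
Proof.
have /card_gt0P[i] : (0 < #|predC1 s.1|)%N by rewrite cardC1 card_ord; lia.
by rewrite inE => si; exists (i, false).
Qed.

Lemma letter_neq (s v : letter k) : v.1 != s.1 -> v != s.
Proof. by apply: contraNneq => ->. Qed.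

(* The loops [s v s^-1 v^-1] and [s s v s^-1 s^-1 v^-1]. *)
Lemma even_loop s g n : ~~ odd n -> (4 <= n)%N -> 0 < P n s g s g.
Proof.
have [v vs] := other_letter s.
have vs' : s.1 != v.1 by rewrite eq_sym.
have l4 g' : 0 < P 4 s g' s g'.
  have := @nb_walk [:: v; linv s; linv v] s s g'; rewrite /= linvK.
  rewrite (TC (linv s)) TK TK; apply.
  by rewrite !letter_neq.
have l6 g' : 0 < P 6 s g' s g'.
  have := @nb_walk [:: s; v; linv s; linv s; linv v] s s g'; rewrite /= !linvK.
  rewrite 2!(TC (linv s) v) TK TK TK; apply.
  by rewrite (eq_sym (linv s) s) !linv_neq !letter_neq.
(* Every even [n >= 4] is a sum of 4s and 6s. *)
elim/ltn_ind: n => n IH on n4.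
have [->//|n4'] := eqVneq n 4; have [->//|n6] := eqVneq n 6.
rewrite -(subnKC n4); apply: nb_comp (l4 g) (IH _ _ _ _); last by lia.
  by lia.
by rewrite oddB // (negbTE on).
Qed.

(** The loops are [s] if [u = s], then [s v s^-1 s^-1 v^-1] if [u = s^-1], and [s u u s^-1 u^-1]
    otherwise. Their odd length lets [run_loop] keep track of the parity of the word. *)
Lemma letter_loop s u g : exists2 n, odd n & 0 < P n s g s (T u g).
Proof.
have [v vs] := other_letter s.
have vs' : s.1 != v.1 by rewrite eq_sym.
have [->|us] := eqVneq u s.
  by exists 1%N => //; apply: (@nb_walk [::]); rewrite /= linv_neq.
have [->|us'] := eqVneq u (linv s).
  exists 5%N => //.
  have := @nb_walk [:: v; linv s; linv s; linv v] s s g; rewrite /= !linvK.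
  rewrite 2!(TC (linv s) v) 2!TK; apply.
  by rewrite (eq_sym (linv s) s) !linv_neq !letter_neq.
have us1 : u.1 != s.1.
  apply/eqP => ij; move: us us'; rewrite [u]surjective_pairing ij.
  by case: s {v vs vs' ij} => j c; rewrite /linv !xpair_eqE !eqxx; case: u.2 c => [] [].
exists 5%N => //.
have us1' : s.1 != u.1 by rewrite eq_sym.
have := @nb_walk [:: u; u; linv s; linv u] s s g; rewrite /= !linvK.
rewrite 2!(TC (linv s) u) TK TK; apply.
by rewrite linv_neq !letter_neq.
Qed.

Lemma run_loop s w g :
  exists2 n, odd n = odd (size w) & 0 < P n s g s (run T w g).
Proof.
elim: w g => [|u w IH] g /=; first by exists 0%N; rewrite // /kpow eqxx.
have [m om mP] := letter_loop s u g; have [n on nP] := IH (T u g).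
by exists (m + n)%N; [rewrite oddD om on | apply: nb_comp mP nP].
Qed.

(** First reach the letter [t] in one or two steps, then correct the second component by loops at
    [t]. *)
Lemma nb_connected s t g g' : exists n, 0 < P n s g t g'.
Proof.
have [n [g'' sP]] : exists n g'', 0 < P n s g t g''.
  have [->|ts] := eqVneq t (linv s); last first.
    by exists 1%N, (T s g); apply: (@nb_walk [::]); rewrite /= ts.
  have [v vs] := other_letter s; exists 2%N, (T v (T s g)).
  apply: (@nb_walk [:: v]) => /=.
  by rewrite !letter_neq //= eq_sym.
have [w wg] := T_trans g'' g'; have [m _ mP] := run_loop t w g''.
by exists (n + m)%N; apply: nb_comp sP _; rewrite -wg.
Qed.

(** Even loops at the starting state pad all the connecting times to one common even value. *)
Lemma even_mixing_time (D : rel (letter k * G)) :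
    (forall x y, D x y -> exists2 n, ~~ odd n & 0 < kpow nb_ker n x y) ->
  exists r, [/\ (0 < r)%N, ~~ odd r & forall x y, D x y -> 0 < kpow nb_ker r x y].
Proof.
move=> De.
have [n nP] : exists n : letter k * G -> letter k * G -> nat, forall x y,
    D x y -> ~~ odd (n x y) /\ 0 < kpow nb_ker (n x y) x y.
  suff : forall x, exists f : letter k * G -> nat, forall y,
      D x y -> ~~ odd (f y) /\ 0 < kpow nb_ker (f y) x y.
    exact: fin_all_exists.
  move=> x; apply: (@fin_all_exists _ (fun=> nat)
    (fun y n => D x y -> ~~ odd n /\ 0 < kpow nb_ker n x y)) => y.
  have [/De[n on nP]|_] := boolP (D x y); first by exists n.
  by exists 0%N.
pose N := (\sum_x \sum_y n x y)%N.
(* [N] bounds every [n x y], so the padding still has length at least 4, as [even_loop] requires. *)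
exists (N + 2).*2; split => [||x y xy]; first by rewrite double_gt0 addnS.
  by rewrite odd_double.
have [on nxy] := nP x y xy.
have nN : (n x y <= N)%N.
  by rewrite /N (bigD1 x) //= (bigD1 y) //= -addnA leq_addr.
have -> : ((N + 2).*2 = ((N + 2).*2 - n x y) + n x y)%N by lia.
case: x y {xy} on nxy nN => s g [t g'] on nxy nN.
apply: nb_comp nxy; apply: even_loop; last by lia.
by rewrite oddB ?odd_double ?(negbTE on) //; lia.
Qed.

(** The word [w0], odd and acting trivially, gives odd loops at every state; these turn an odd
    connecting time into an even one. *)
Lemma nb_cvg_uniform w0 : odd (size w0) -> (forall g, run T w0 g = g) ->
  forall x y, kpow nb_ker n x y @[n --> \oo] --> (#|{: letter k * G}|%:R^-1 : R).
Proof.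
move=> ow w0K.
have [|r [r0 _ rP]] := @even_mixing_time (fun=> xpredT).
  move=> [s g] [t g'] _; have [n nP] := nb_connected s t g g'.
  have [on|] := boolP (odd n); last by exists n.
  have [m om mP] := run_loop s w0 g; rewrite w0K in mP.
  by exists (m + n)%N; [rewrite oddD om ow on | apply: nb_comp mP nP].
apply: (kpow_cvg_uniform nb_ker_ge0 nb_ker_row nb_ker_col r0) => x y.
exact: rP.
Qed.

Lemma nb_cvg_bipartite (c : G -> bool) : (forall s g, c (T s g) = ~~ c g) ->
  forall x y, kpow nb_ker n x y -
      ((c x.2 (+) odd n) == c y.2)%:R * (2 / #|{: letter k * G}|%:R)
    @[n --> \oo] --> (0 : R).
Proof.
move=> cT.
have K0 x y : c x.2 = c y.2 -> nb_ker x y = 0.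
  move=> xy; rewrite /nb_ker /nb_step.
  have [yx|] := eqVneq y.2 (T x.1 x.2); rewrite ?andbF ?mul0r //.
  by move: xy; rewrite yx cT; case: (c _).
have [|r [r0 er rP]] := @even_mixing_time (fun x y => c x.2 == c y.2).
  move=> [s g] [t g'] /eqP /= gg'; have [n nP] := nb_connected s t g g'.
  (* Within one class a connecting time is automatically even. *)
  exists n => //; apply: contraTN nP => on.
  by rewrite (kpow_bipartite0 K0) ?ltxx //= on gg'; case: (c _).
apply: (kpow_cvg_bipartite nb_ker_ge0 nb_ker_row nb_ker_col K0 r0 er) => x y.
by move=> /eqP; apply: rP.
Qed.

Lemma card_states : #|{: letter k * G}|%:R = (k * 2)%:R * #|G|%:R :> R.
Proof. by rewrite card_prod natrM card_letter. Qed.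

Lemma trace_cvg w0 : odd (size w0) -> (forall g, run T w0 g = g) ->
  forall g g', \sum_s P n s g s g' @[n --> \oo] --> (#|G|%:R^-1 : R).
Proof.
move=> ow w0K g g'.
have -> : (#|G|%:R^-1 : R) = \sum_(s : letter k) #|{: letter k * G}|%:R^-1.
  rewrite sumr_const card_letter card_states invfM -[RHS]mulr_natl.
  by rewrite mulrA divff ?mul1r // pnatr_eq0; lia.
by apply: cvg_sumr => s; apply: nb_cvg_uniform ow w0K _ _.
Qed.

Lemma trace_pair_cvg (c : G -> bool) : (forall s g, c (T s g) = ~~ c g) ->
  forall g g', \sum_s P n s g s g' + \sum_s P n.+1 s g s g'
    @[n --> \oo] --> (2 / #|G|%:R : R).
Proof.
move=> cT g g'.
(* [w n] is the oscillating main term of the trace. Exactly one of [n] and [n.+1] has the matching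
   parity, so [w n + w n.+1] is constant. *)
pose w n : R :=
  \sum_(s : letter k) ((c g (+) odd n) == c g')%:R * (2 / #|{: letter k * G}|%:R).
have wP n : w n + w n.+1 = 2 / #|G|%:R.
  rewrite /w -big_split /=; under eq_bigr do rewrite -mulrDl.
  rewrite sumr_const card_letter card_states -[LHS]mulr_natl.
  have -> : ((c g (+) odd n) == c g')%:R + ((c g (+) ~~ odd n) == c g')%:R = 1 :> R.
    by case: (c g); case: (odd n); case: (c g'); rewrite /= ?addr0 ?add0r.
  have k0 : (k * 2)%:R != 0 :> R by rewrite pnatr_eq0; lia.
  have G0 : #|G|%:R != 0 :> R by rewrite pnatr_eq0 -lt0n; apply/card_gt0P; exists g.
  move: k0 G0; move: (k * 2)%:R #|G|%:R => a b a0 b0.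
  by field; rewrite a0 b0.
have cv : \sum_s P n s g s g' - w n @[n --> \oo] --> (0 : R).
  have -> : (fun n => \sum_s P n s g s g' - w n) = (fun n => \sum_s (P n s g s g'
      - ((c g (+) odd n) == c g')%:R * (2 / #|{: letter k * G}|%:R))).
    by apply/funext => n; rewrite sumrB.
  suff cv0 : \sum_s (P n s g s g' - ((c g (+) odd n) == c g')%:R *
      (2 / #|{: letter k * G}|%:R)) @[n --> \oo] --> (\sum_(s : letter k) 0 : R).
    by move: cv0; rewrite big1.
  by apply: cvg_sumr => s; apply: (nb_cvg_bipartite cT (s, g) (s, g')).
have cvS : \sum_s P n.+1 s g s g' - w n.+1 @[n --> \oo] --> (0 : R).
  by move: cv; rewrite -cvg_shiftS.
have := cvgD cv cvS; rewrite addr0 => cv0.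
apply: (@cvg_sub0 _ _ _ _ _ _ (fun n => w n + w n.+1)).
  rewrite [X in X @ _](_ : _ = (fun n => \sum_s P n s g s g' - w n)
      \+ (fun n => \sum_s P n.+1 s g s g' - w n.+1)); first exact: cv0.
  by apply/funext => n; rewrite !fctE opprD addrACA.
have -> : (fun n => w n + w n.+1) = (fun=> 2 / #|G|%:R) by apply/funext => n.
exact: cvg_cst.
Qed.
End Walk.

(** * Counting cyclically reduced words by closed walks *)

Fixpoint words k n : seq (seq (letter k)) :=
  if n is n'.+1 then [seq s :: w | s <- enum {: letter k}, w <- words k n']
  else [:: [::]].

Lemma mem_words k n (w : seq (letter k)) : (w \in words k n) = (size w == n).
Proof.
elim: n w => [|n IH] [|s w] //=; first by apply/negP => /allpairsP[[? ?] []].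
rewrite eqSS -IH; apply/allpairsP/idP => [[[t v] /= [_ vn [_ ->]]]|wn] //.
by exists (s, w); rewrite mem_enum.
Qed.

Lemma words_uniq k n : uniq (words k n).
Proof.
elim: n => //= n IH; apply: allpairs_uniq => //; first exact: enum_uniq.
by move=> [s w] [t v] _ _ /= [-> ->].
Qed.

Lemma count_wordsS k n (p : pred (seq (letter k))) :
  count p (words k n.+1) = (\sum_s count (fun w => p (s :: w)) (words k n))%N.
Proof.
rewrite /= count_flatten -map_comp sumnE big_map big_enum /=.
by apply: eq_bigr => s _; rewrite count_map.
Qed.

Definition cyc_reduced k (w : seq (letter k)) :=
  reduced w && (if w is s :: w' then s != linv (last s w') else true).

Section CountWalks.
Variables (R : realType) (k : nat) (G : finType) (T : letter k -> G -> G).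
Notation q := (k * 2).-1.
Hypothesis k_gt1 : (1 < k)%N.

(** [t] is the letter following [w]. The default [t] in [head t w] makes the empty word a walk from
    [s] to [t] exactly when [s = t], matching [kpow] at 0. *)
Definition walk_pred (s t : letter k) g g' (w : seq (letter k)) :=
  [&& reduced (rcons w t), head t w == s & run T w g == g'].

Lemma count_walk_predS s t g g' n :
  count (walk_pred s t g g') (words k n.+1) =
  count (fun w => reduced (s :: rcons w t) && (run T w (T s g) == g')) (words k n).
Proof.
rewrite count_wordsS (bigD1 s) //= big1 ?addn0 => [|u /negbTE us].
  by apply: eq_count => w; rewrite /walk_pred /= eqxx.
apply/eqP; rewrite -leqn0 leqNgt -has_count; apply/hasPn => w _.
by rewrite /walk_pred /= us andbF.
Qed.

Lemma count_walks n s t g g' :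
  (count (walk_pred s t g g') (words k n))%:R =
  kpow (nb_ker R T) n (s, g) (t, g') * q%:R ^+ n.
Proof.
have q0 : q%:R != 0 :> R by rewrite pnatr_eq0; lia.
elim: n s g => [|n IH] s g.
  rewrite /kpow expr0 mulr1 /= addn0 /walk_pred /= xpair_eqE.
  by rewrite (eq_sym t).
rewrite count_walk_predS /kpow -/(kpow (nb_ker R T)).
(* Split according to the second letter [u] of the path, which is [t] itself when [w] is empty. *)
have -> : count (fun w => reduced (s :: rcons w t) && (run T w (T s g) == g'))
    (words k n) =
    (\sum_u (u != linv s) * count (walk_pred u t (T s g) g') (words k n))%N.
  under eq_bigr do rewrite -sum1_count big_mkcond big_distrr /=.
  rewrite -sum1_count big_mkcond exchange_big /=; apply: eq_bigr => w _.
  rewrite (bigD1 (head t w)) //= big1 ?addn0 => [|u uw]; last first.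
    by rewrite /walk_pred [_ == u]eq_sym (negbTE uw) /= andbF muln0.
  rewrite /walk_pred eqxx /=.
  by case: w => [|u w]; rewrite /reduced /=;
    case: (_ != _); rewrite ?mul0n ?mul1n ?andbT.
rewrite natr_sum mulr_suml.
transitivity (\sum_(u : letter k) \sum_g1
  nb_ker R T (s, g) (u, g1) * kpow (nb_ker R T) n (u, g1) (t, g') * q%:R ^+ n.+1);
  last by rewrite pair_bigA; apply: eq_bigr => -[].
apply: eq_bigr => u _; rewrite (bigD1 (T s g)) //= big1 ?addr0 => [|g1 /negbTE ng].
  rewrite natrM IH /nb_ker /nb_step /= eqxx andbT exprS.
  by field.
by rewrite /nb_ker /nb_step /= ng andbF !mul0r.
Qed.

(** For a word starting with [s], reducedness after appending [s] is cyclic reducedness. Length 0 is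
    excluded: there the trace would count the empty word once per letter. *)
Lemma count_cyc_reduced n g g' :
  (count (fun w => cyc_reduced w && (run T w g == g')) (words k n.+1))%:R =
  (\sum_s kpow (nb_ker R T) n.+1 (s, g) (s, g')) * q%:R ^+ n.+1 :> R.
Proof.
rewrite mulr_suml; under [RHS]eq_bigr do rewrite -count_walks count_walk_predS.
rewrite -natr_sum count_wordsS; congr _%:R; apply: eq_bigr => s _.
by apply: eq_count => w; rewrite /cyc_reduced /reduced /= rcons_path.
Qed.
End CountWalks.

(** * From elements of the free group to words *)

Lemma fword_fprod k (w : seq (letter k)) : reduced w -> fword (Defs.fprod w) = w.
Proof. by move=> rw; rewrite (Defs.fprodK (FreeWord rw)). Qed.

Lemma fletter_linv k (s t : letter k) : (fletter s * fletter t = 1)%g <-> s = linv t.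
Proof.
split=> [st|->].
  have /(congr1 (@fword k)) : fletter s = ((fletter t)^-1)%g 
    by rewrite -[LHS]mulg1 -(mulgV (fletter t)) mulgA st mul1g.
  by rewrite fword_fletter /= /winv fword_fletter => -[->].
by case: t => i [] /=; rewrite /fletter /= ?mulgV ?mulVg.
Qed.

Lemma cyclically_reducedP k (x : freegroup k) :
  reflect (cyclically_reduced x) (cyc_reduced x).
Proof.
rewrite /cyc_reduced fwordP /cyclically_reduced; case: (fword x) => [|s w] /=.
  exact: ReflectT.
by apply: (iffP idP) => [/eqP h /fletter_linv|h] //; apply/eqP => /fletter_linv.
Qed.

(** Reduced words are normal forms, so [fprod] is injective on them and a ball can be counted sphere
    by sphere. *)
Lemma card_fset_set_words k (A : set (freegroup k)) (p : pred (seq (letter k))) m :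
    (forall w, p w -> reduced w) ->
    (forall x, A x <-> p (fword x) /\ (wl x <= m)%N) ->
  #|` fset_set A|%fset = (\sum_(n < m.+1) count p (words k n))%N.
Proof.
move=> pr AP.
pose L := flatten [seq [seq w <- words k n | p w] | n <- iota 0 m.+1].
have memL w : (w \in L) = p w && (size w <= m)%N.
  apply/flatten_mapP/andP => [[n]|[pw wm]].
    by rewrite mem_iota mem_filter mem_words => + /andP[-> /eqP ->].
  by exists (size w); rewrite ?mem_iota // mem_filter mem_words pw eqxx.
have -> : fset_set A = [fset Defs.fprod w | w in L]%fset.
  apply/fsetP => x; rewrite in_fset_set; last first.
    by apply: sub_finite_set (finite_ball k m) => y /AP[].
  apply/idP/imfsetP => /= [|[w wL ->]].
    rewrite inE => /AP[px xm]; exists (fword x); last by rewrite Defs.fprodK.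
    by rewrite memL px -wlE.
  move: wL; rewrite memL => /andP[pw wm].
  by rewrite inE; apply/AP; rewrite wlE fword_fprod ?pr.
have Lu : uniq L.
  rewrite /L; elim: (iota 0 m.+1) (iota_uniq 0 m.+1) => //= n s IH /andP[ns us].
  rewrite cat_uniq filter_uniq ?words_uniq // IH // andbT /=.
  apply/hasPn => w /flatten_mapP[n' n's].
  rewrite !mem_filter !mem_words => /andP[_ /eqP wn']; rewrite negb_and.
  by apply/orP; right; rewrite wn'; apply: contraNneq ns => <-.
rewrite card_in_imfset /=; last first.
  move=> w v; rewrite !memL => /andP[pw _] /andP[pv _] wv.
  by rewrite -(fword_fprod (pr _ pw)) wv fword_fprod ?pr.
rewrite undup_id // size_flatten sumnE /shape -map_comp big_map.
rewrite -[m.+1]subn0 -/(index_iota 0 m.+1) big_mkord.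
by apply: eq_bigr => n _ /=; rewrite size_filter.
Qed.

(** * The action of letters on the product of the groups Z/l_i *)

Section Residues.
Variables (k : nat) (l : 'I_k -> nat).
Hypothesis l_gt0 : forall i, (0 < l i)%N.

Definition residues : finType := {dffun forall i : 'I_k, 'I_(l i)}.

Definition shift (s : letter k) (g : residues) : residues :=
  [ffun i : 'I_k => if i == s.1 then if s.2 then ord_pred (g i) else ordS (g i)
                    else g i].

Definition exponent_sum (i : 'I_k) (w : seq (letter k)) : int :=
  \sum_(s <- w | s.1 == i) (-1) ^+ s.2.

Lemma card_residues : #|residues| = (\prod_(i < k) l i)%N.
Proof.
rewrite [LHS]card_dep_ffun foldrE big_map big_enum /=.
by apply: eq_bigr => i _; rewrite card_ord.
Qed.

Lemma shiftK s : cancel (shift s) (shift (linv s)).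
Proof.
move=> g; apply/ffunP => i; rewrite !ffunE /=.
by case: eqP => // _; case: s.2 => /=; rewrite ?ordSK ?ord_predK.
Qed.

Lemma shiftC s t g : shift s (shift t g) = shift t (shift s g).
Proof.
apply/ffunP => i; rewrite !ffunE; case: (i == s.1); case: (i == t.1) => //.
by case: s.2; case: t.2; rewrite ?ordSK ?ord_predK.
Qed.

Lemma shift_modz s g i :
  ((shift s g i)%:Z = (g i)%:Z + (if s.1 == i then (-1) ^+ s.2 else 0)
    %[mod (l i)%:Z])%Z.
Proof.
rewrite ffunE eq_sym; case: eqP => _; last by rewrite addr0.
case: s.2 => /=; rewrite modz_nat modn_mod -modz_nat ?expr0 ?expr1.
  have -> : ((g i + l i).-1)%:Z = ((g i)%:Z - 1) + (l i)%:Z by have := l_gt0 i; lia.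
  by rewrite modzDr.
by rewrite -addn1 PoszD.
Qed.

Lemma run_modz w g i :
  ((run shift w g i)%:Z = (g i)%:Z + exponent_sum i w %[mod (l i)%:Z])%Z.
Proof.
rewrite /exponent_sum; elim: w g => [|s w IH] g /=; first by rewrite big_nil addr0.
rewrite IH big_cons -modzDml shift_modz modzDml.
by case: ifP => _; rewrite ?addr0 // addrA.
Qed.

Lemma residues_eqP (g g' : residues) :
  reflect (forall i, ((g i)%:Z = (g' i)%:Z %[mod (l i)%:Z])%Z) (g == g').
Proof.
apply: (iffP eqP) => [->//|gg']; apply/ffunP => i; apply: val_inj.
by move: (gg' i); rewrite !modz_nat !modn_small // => -[].
Qed.

Definition residue_of (a : 'I_k -> int) : residues :=
  [ffun i : 'I_k => Ordinal (ltn_pmod `|(a i %% (l i)%:Z)%Z|%N (l_gt0 i))].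

Lemma residue_of_modz a i : ((residue_of a i)%:Z = a i %[mod (l i)%:Z])%Z.
Proof.
rewrite ffunE /= -modz_nat modz_mod gez0_abs ?modz_mod ?modz_ge0 //.
by rewrite eqz_nat -lt0n.
Qed.

Lemma run_residue_of w a :
  reflect (forall i, (exponent_sum i w = a i %[mod (l i)%:Z])%Z)
          (run shift w (residue_of (fun=> 0)) == residue_of a).
Proof.
apply: (iffP (residues_eqP _ _)) => h i; move: (h i);
  by rewrite run_modz -modzDml !residue_of_modz mod0z add0r.
Qed.

Lemma exponent_sum_nseq i j n :
  exponent_sum i (nseq n (j, false)) = (if j == i then n else 0)%:Z.
Proof.
rewrite /exponent_sum big_nseq_cond /=; case: eqP => // _.
by elim: n => //= n ->; rewrite expr0 -PoszD.
Qed.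

Lemma shift_trans g g' : exists w, run shift w g = g'.
Proof.
(* Adding [l i] keeps the exponent nonnegative, so positive letters suffice. *)
pose n i := (g' i + (l i - g i))%N.
exists (flatten [seq nseq (n i) (i, false) | i <- enum 'I_k]).
apply/eqP/residues_eqP => i; rewrite run_modz.
have -> : exponent_sum i (flatten [seq nseq (n i) (i, false) | i <- enum 'I_k]) = n i.
  rewrite /exponent_sum big_flatten big_map big_enum /=.
  rewrite (eq_bigr (fun j => (if j == i then n j else 0)%:Z)) => [|j _]; last first.
    exact: exponent_sum_nseq.
  by rewrite (bigD1 i) //= eqxx big1 ?addr0 // => j /negbTE ->.
have -> : (g i)%:Z + n i = (g' i)%:Z + (l i)%:Z.
  by have := ltn_ord (g i); rewrite /n; lia.
by rewrite modzDr.
Qed.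

(** For odd [l j] this supplies the odd word acting trivially that makes the walk aperiodic. *)
Lemma run_nseq_period j g : run shift (nseq (l j) (j, false)) g = g.
Proof.
apply/eqP/residues_eqP => i; rewrite run_modz exponent_sum_nseq.
by case: eqP => [->|_]; rewrite ?modzDr ?addr0.
Qed.

Definition parity (g : residues) := odd (\sum_i g i).

(** Reduction modulo an even number preserves parity, so wrapping around does no harm. *)
Lemma parity_shift s g : (forall i, 2 %| l i)%N -> parity (shift s g) = ~~ parity g.
Proof.
move=> l2; rewrite /parity (bigD1 s.1) //= [in RHS](bigD1 s.1) //= !oddD ffunE eqxx.
rewrite (eq_bigr (fun i => g i : nat)) => [|i /negbTE si]; last by rewrite ffunE si.
rewrite -addNb; congr (_ (+) _).
have ol m : odd (m %% l s.1) = odd m.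
  have := l2 s.1; rewrite dvdn2 => /negbTE le.
  by rewrite [in RHS](divn_eq m (l s.1)) oddD oddM le andbF.
case: s.2; rewrite /= ol //.
have := l2 s.1; rewrite dvdn2 => /negbTE le.
(* [ord_pred] computes [(g + l).-1] modulo [l]; adding the even [l] makes the argument of the
   predecessor positive. *)
have -> : odd (g s.1) = odd (g s.1 + l s.1)%N by rewrite oddD le addbF.
have : (0 < g s.1 + l s.1)%N by rewrite addn_gt0 l_gt0 orbT.
by case: (_ + _)%N => //= n _; rewrite negbK.
Qed.
End Residues.

(** * Limits of the sphere densities *)

Section Count.
Variables (R : realType) (k : nat) (l : 'I_k -> nat) (a : 'I_k -> int).
Hypotheses (k_gt1 : (1 < k)%N) (l_gt0 : forall i, (0 < l i)%N).
Notation q := (k * 2).-1.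

Definition sphere_count n : nat :=
  count (fun w => cyc_reduced w &&
    (run (@shift k l) w (residue_of l_gt0 (fun=> 0)) == residue_of l_gt0 a))
  (words k n).

Definition sphere_density n : R := (sphere_count n)%:R / q%:R ^+ n.

Lemma N_Gamma_sum m : N_Gamma l a m = (\sum_(n < m.+1) sphere_count n)%N.
Proof.
apply: card_fset_set_words => [w /andP[/andP[]] //|x].
rewrite /congr_ball_c /Gamma_c /=; split=> [[/cyclically_reducedP xr xm xa]|].
  by split=> //; rewrite xr; apply/run_residue_of => i; apply: xa.
by move=> [/andP[/cyclically_reducedP xr /run_residue_of xa] xm].
Qed.

Let trace n : R := \sum_s kpow (nb_ker R (@shift k l)) n
  (s, residue_of l_gt0 (fun=> 0)) (s, residue_of l_gt0 a).

Lemma sphere_densityS n : sphere_density n.+1 = trace n.+1.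
Proof.
rewrite /sphere_density count_cyc_reduced // mulfK // expf_neq0 // pnatr_eq0; lia.
Qed.

Lemma sphere_density_cvg : (exists i, odd (l i)) ->
  sphere_density n @[n --> \oo] --> ((\prod_(i < k) l i)%N%:R^-1 : R).
Proof.
move=> [j oj]; rewrite -cvg_shiftS /=.
have -> : (fun n => sphere_density n.+1) = (fun n => trace n.+1).
  by apply/funext => n; apply: sphere_densityS.
rewrite (cvg_shiftS trace).
rewrite -card_residues; apply: (trace_cvg _ _ _ _ (w0 := nseq (l j) (j, false))) => //.
- exact: shiftK.
- exact: shiftC.
- exact: shift_trans.
- by rewrite size_nseq.
- exact: run_nseq_period.
Qed.

Lemma sphere_density_pair_cvg : (forall i, 2 %| l i)%N ->
  sphere_density n + sphere_density n.+1 @[n --> \oo]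
    --> (2 / (\prod_(i < k) l i)%N%:R : R).
Proof.
move=> l2; rewrite -cvg_shiftS /=.
have -> : (fun n => sphere_density n.+1 + sphere_density n.+2)
    = (fun n => trace n.+1 + trace n.+2).
  by apply/funext => n; rewrite !sphere_densityS.
rewrite (cvg_shiftS (fun n => trace n + trace n.+1)).
rewrite -card_residues; apply: (trace_pair_cvg _ _ _ _ (c := @parity k l)) => //.
- exact: shiftK.
- exact: shiftC.
- exact: shift_trans.
- by move=> s g; apply: parity_shift.
Qed.
End Count.

Lemma total_Gamma_eq k m : total_Gamma k m = @N_Gamma k (fun=> 1%N) (fun=> 0) m.
Proof.
rewrite /total_Gamma /N_Gamma; congr #|` fset_set _|%fset.
by apply/seteqP; split=> x /= => [[xc xm]|[]//]; split=> // i; rewrite !modz1.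
Qed.

(** * Geometrically weighted averages *)

Section Asymptotics.
Variable R : realType.

Lemma contraction_cvg0 (r : R) (e d : nat -> R) : 0 <= r < 1 ->
    (forall n, e n.+1 = r * e n + d n) -> d n @[n --> \oo] --> (0 : R) ->
  e n @[n --> \oo] --> (0 : R).
Proof.
move=> /andP[r0 r1] eS d0; apply/cvgr0Pnorm_le => eps eps0.
have r1' : 0 < 1 - r by rewrite subr_gt0.
(* With inputs at most [eps / 2 * (1 - r)], the recursion [b = r * b + eps / 2 * (1 - r)] has fixed
   point [eps / 2]; the excess over it decays like [r ^+ j]. *)
have [|N _ dN] := (cvgr0_norm_le _ d0) (eps / 2 * (1 - r)).
  by rewrite mulr_gt0 // divr_gt0.
have geo : `|e N| * r ^+ j @[j --> \oo] --> (0 : R).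
  by rewrite -(mulr0 `|e N|); apply: cvgMr; apply: cvg_expr; rewrite ger0_norm.
have [|J _ JP] := (cvgr0_norm_le _ geo) (eps / 2); first by rewrite divr_gt0.
have bound j : `|e (N + j)%N| <= `|e N| * r ^+ j + eps / 2.
  elim: j => [|j IH].
    by rewrite addn0 expr0 mulr1 lerDl divr_ge0 // ltW.
  rewrite addnS eS (le_trans (ler_normD _ _)) // normrM ger0_norm //.
  have := dN (N + j)%N (leq_addr _ _); rewrite /= => dj.
  apply: (le_trans (lerD (ler_wpM2l r0 IH) dj)).
  by rewrite exprS; lra.
exists (N + J)%N => // n /= Jn; rewrite -(subnKC (leq_trans (leq_addr J N) Jn)).
apply: (le_trans (bound _)).
have := JP (n - N)%N; rewrite /= => /(_ _)/(le_trans (ler_norm _)) geoJ.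
have : `|e N| * r ^+ (n - N) <= eps / 2 by apply: geoJ; lia.
lra.
Qed.

(** The averages satisfy [S m.+1 = q^-1 * S m + v m.+1]. For constant [v = c] the fixed point is
    [c * (q / (q - 1))], and the deviation from it contracts by [q^-1]. *)
Lemma geometric_average_cvg (q c : R) (v : nat -> R) : 1 < q ->
    v n @[n --> \oo] --> c ->
  (\sum_(n < m.+1) v n * q ^+ n) / q ^+ m @[m --> \oo] --> c * (q / (q - 1)).
Proof.
move=> q1 vc.
have q0 : 0 < q by apply: lt_trans q1.
have q'0 : q != 0 by rewrite gt_eqF.
have q'1 : q - 1 != 0 by rewrite subr_eq0 gt_eqF.
pose S m := (\sum_(n < m.+1) v n * q ^+ n) / q ^+ m.
have SS m : S m.+1 = q^-1 * S m + v m.+1.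
  rewrite /S big_ord_recr /= mulrDl mulfK ?expf_neq0 //.
  by congr (_ + _); rewrite exprS invfM mulrCA.
apply: (@cvg_sub0 _ _ _ _ _ _ (fun=> c * (q / (q - 1)))); last exact: cvg_cst.
apply: (@contraction_cvg0 q^-1 (fun m => S m - c * (q / (q - 1)))
                               (fun m => v m.+1 - c)).
- by rewrite invr_ge0 (ltW q0) invf_lt1.
- by move=> m; rewrite SS; field; rewrite q'0 q'1.
- rewrite -(subrr c); apply: cvgB; last exact: cvg_cst.
  by rewrite (cvg_shiftS v).
Qed.
End Asymptotics.

(** * Ball counts and their ratios *)

Lemma N_GammaE (R : realType) k (l : 'I_k -> nat) a
    (k_gt1 : (1 < k)%N) (l_gt0 : forall i, (0 < l i)%N) m :
  (N_Gamma l a m)%:R =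
  \sum_(n < m.+1) sphere_density R a l_gt0 n * (k * 2).-1%:R ^+ n :> R.
Proof.
rewrite (N_Gamma_sum a l_gt0) natr_sum; apply: eq_bigr => n _.
by rewrite /sphere_density divfK // expf_neq0 // pnatr_eq0; lia.
Qed.

Lemma total_Gamma_cvg (R : realType) k : (1 < k)%N ->
  let q : R := (k * 2).-1%:R in
  (total_Gamma k m)%:R / q ^+ m @[m --> \oo] --> q / (q - 1).
Proof.
move=> k1 q; have q1 : 1 < q by rewrite ltr1n; lia.
have l0 (i : 'I_k) : (0 < 1)%N by [].
have -> : (fun m => (total_Gamma k m)%:R / q ^+ m) = (fun m =>
    (\sum_(n < m.+1) sphere_density R (fun=> 0) l0 n * q ^+ n) / q ^+ m).
  by apply/funext => m; rewrite total_Gamma_eq (N_GammaE _ _ k1 l0).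
rewrite -[q / (q - 1)]mul1r; apply: geometric_average_cvg => //.
have := @sphere_density_cvg R k (fun=> 1%N) (fun=> 0) k1 l0.
rewrite (_ : (\prod_(i < k) 1)%N = 1%N) ?invr1; last by rewrite big1.
by apply; exists (Ordinal (ltnW k1)).
Qed.

Lemma N_Gamma_le_total k (l : 'I_k -> nat) a m : (N_Gamma l a m <= total_Gamma k m)%N.
Proof.
apply: fsubset_leq_card; apply/fsubsetP => x.
rewrite !in_fset_set ?inE; [|exact: finite_ball_c|exact: finite_congr_ball_c].
by case.
Qed.

Theorem theorem3p11 (R : realType) (k : nat) (hk : (2 <= k)%N)
    (l : 'I_k -> nat) (hl : forall i, (0 < l i)%N) (a : 'I_k -> int) :
  (~~ (2 %| \big[gcdn/0%N]_(i < k) l i)%N ->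
     ((N_Gamma l a m)%:R / (total_Gamma k m)%:R : R) @[m --> \oo]
       --> ((\prod_(i < k) l i)%N%:R^-1 : R)) /\
  ((forall i, (2 %| l i)%N) ->
     (2^-1 * ((N_Gamma l a m)%:R / (total_Gamma k m)%:R
            + (N_Gamma l a m.+1)%:R / (total_Gamma k m.+1)%:R) : R) @[m --> \oo]
       --> ((\prod_(i < k) l i)%N%:R^-1 : R)).
Proof.
set L : R := (\prod_(i < k) l i)%N%:R.
pose q : R := (k * 2).-1%:R; pose tau := q / (q - 1).
have q1 : 1 < q by rewrite ltr1n; lia.
have qp : 0 < q by apply: lt_trans q1.
have q0 n : q ^+ n != 0 by rewrite expf_neq0 // gt_eqF.
have tau0 : tau != 0 by rewrite gt_eqF // divr_gt0 ?subr_gt0.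
pose u := sphere_density R a hl.
pose x m := (N_Gamma l a m)%:R / q ^+ m : R.
pose t m := (total_Gamma k m)%:R / q ^+ m : R.
pose y m := (N_Gamma l a m)%:R / (total_Gamma k m)%:R : R.
have tC : t m @[m --> \oo] --> tau := @total_Gamma_cvg R k hk.
have xE m : x m = (\sum_(n < m.+1) u n * q ^+ n) / q ^+ m.
  by rewrite /x (N_GammaE _ _ hk hl).
have yt m : y m * t m = x m.
  rewrite /y /t /x mulrA; congr (_ / _).
  (* A zero total forces a zero numerator, so the identity survives division by zero. *)
  have [T0|T0] := eqVneq (total_Gamma k m) 0%N; last by rewrite divfK // pnatr_eq0.
  have := N_Gamma_le_total l a m.
  by rewrite T0 leqn0 => /eqP ->; rewrite mulr0.
have y01 m : 0 <= y m <= 1.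
  rewrite /y divr_ge0 ?ler0n //=.
  have [->|T0] := posnP (total_Gamma k m); first by rewrite invr0 mulr0.
  by rewrite ler_pdivrMr ?ltr0n // mul1r ler_nat N_Gamma_le_total.
split=> [odd_l|even_l].
- have [j oj] : exists j, odd (l j).
    apply/existsP; rewrite -[[exists _, _]]negbK; apply: contra odd_l.
    rewrite negb_exists => /forallP le; apply/dvdn_biggcdP => i _.
    by rewrite dvdn2.
  have xC : x m @[m --> \oo] --> L^-1 * tau.
    rewrite (_ : x = fun m => (\sum_(n < m.+1) u n * q ^+ n) / q ^+ m);
      last exact/funext.
    by apply: geometric_average_cvg => //; apply: sphere_density_cvg => //; exists j.
  have -> : (fun m => (N_Gamma l a m)%:R / (total_Gamma k m)%:R) = (fun m => x m / t m).
    by apply/funext => m; rewrite /x /t invfM invrK mulrACA mulVf ?mulr1.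
  rewrite -[L^-1](mulfK tau0); apply: cvgM => //.
  by apply: cvgV.
- have xxC : x m + x m.+1 @[m --> \oo] --> 2 / L * tau.
    (* Splitting off the term [n = 0] of [x m.+1] and reindexing pairs [u n] with [u n.+1]; the
       split term [u 0 / q ^+ m.+1] tends to 0. *)
    have -> : (fun m => x m + x m.+1) = (fun m =>
        (\sum_(n < m.+1) (u n + u n.+1) * q ^+ n) / q ^+ m + u 0%N / q * q^-1 ^+ m).
      apply/funext => m; rewrite !xE.
      under [in RHS]eq_bigr do rewrite mulrDl.
      rewrite big_split mulrDl -addrA /=; congr (_ + _).
      rewrite [in LHS]big_ord_recl /= expr0 mulr1 mulrDl addrC; congr (_ + _).
        by rewrite exprS exprVn invfM mulrA.
      rewrite (eq_bigr (fun i : 'I_m.+1 => q * (u i.+1 * q ^+ i))); last first.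
        by move=> i _; rewrite /bump add1n exprS mulrCA.
      by rewrite -mulr_sumr exprS invfM mulrACA divff ?mul1r ?gt_eqF.
    have avgC : (\sum_(n < m.+1) (u n + u n.+1) * q ^+ n) / q ^+ m @[m --> \oo]
        --> 2 / L * tau.
      by apply: (geometric_average_cvg (v := fun n => u n + u n.+1)) => //;
        apply: sphere_density_pair_cvg.
    have geoC : u 0%N / q * q^-1 ^+ m @[m --> \oo] --> (0 : R).
      rewrite -(mulr0 (u 0%N / q)); apply: cvgMr; apply: cvg_expr.
      by rewrite ger0_norm ?invf_lt1 ?invr_ge0 ?(ltW qp).
    have := cvgD avgC geoC; rewrite addr0; exact.
  (* [y] itself may oscillate, but it is bounded, so [t m] may be replaced by its limit [tau] in
     [y m * t m = x m]. *)
  have dC : y m * (tau - t m) @[m --> \oo] --> (0 : R).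
    apply/cvgr0Pnorm_le => e e0.
    have t0 : tau - t m @[m --> \oo] --> (0 : R).
      by rewrite -(subrr tau); apply: (cvgB (cvg_cst tau) tC).
    have [N _ tN] := (cvgr0_norm_le _ t0) e e0; exists N => // m /tN /=.
    apply: le_trans; have /andP[ym0 ym1] := y01 m.
    by rewrite normrM ger0_norm // ler_piMl.
  have dSC : y m.+1 * (tau - t m.+1) @[m --> \oo] --> (0 : R).
    by rewrite (cvg_shiftS (fun m => y m * (tau - t m))).
  have -> : (fun m => 2^-1 * ((N_Gamma l a m)%:R / (total_Gamma k m)%:R
        + (N_Gamma l a m.+1)%:R / (total_Gamma k m.+1)%:R)) =
      (fun m => 2^-1 * tau^-1 * ((x m + x m.+1) +
        (y m * (tau - t m) + y m.+1 * (tau - t m.+1)))).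
    apply/funext => m; rewrite -/(y m) -/(y m.+1) -!yt.
    move: (t m) (t m.+1) (y m) (y m.+1) => b b' c c'.
    by clear -tau0; clearbody tau; field.
  have -> : L^-1 = 2^-1 * tau^-1 * (2 / L * tau + (0 + 0)).
    by rewrite !addr0; move: L^-1 => w; clear -tau0; clearbody tau; field.
  by apply: cvgMr; apply: (cvgD xxC (cvgD dC dSC)).
Qed.
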